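(* Let $q$ be a power of an odd prime, $m \ge 2$ and $\varepsilon \in \{+1,-1\}$, and let $G_1^{\varepsilon} = \langle T_{v^\perp}, \mathcal{A}\rangle = T_{v^\perp}:\mathcal{A}$ be the group defined in the context. Then $G_1^\varepsilon$ is a nonabelian group of order $q^{2m}$ in which the nonidentity elements can be partitioned into $D_0 \cup D_1 \cup D_2$, where each $D_i$ is a partial difference set in $G_1^\varepsilon$, $\mathrm{Cay}(G_1^\varepsilon, D_0) \cong \mathrm{VO}^\varepsilon(2m,q)$, and $\mathrm{Cay}(G_1^\varepsilon, D_1) \cong \mathrm{Cay}(G_1^\varepsilon, D_2) \cong \mathrm{VNO}^\varepsilon(2m,q)$.
   Context: Partial difference sets. A $(v,k,\lambda,\mu)$-partial difference set (PDS) in a finite group $G$ of order $v$ is a subset $D$ with $|D|=k$ such that every nonidentity element of $D$ can be written as $d_1d_2^{-1}$ with $d_1,d_2\in D$ in exactly $\lambda$ ways, and every nonidentity element of $G - D$ in exactly $\mu$ ways. PDSs are assumed regular: $1_G\notin D$ and $D=D^{-1}$. $\mathrm{Cay}(G,D)$ is the graph with vertex set $G$ in which $g,h$ are adjacent iff $gh^{-1}\in D$. Quadratic form. $V=\mathbb{F}_q^{2m}$ (row vectors, standard basis $e_1,\dots,e_{2m}$) carries the quadratic form $Q(x)=x_1x_2+x_3x_4+\cdots+x_{2m-1}x_{2m}$ if $\varepsilon=+1$, and $Q(x)=x_1x_2+\cdots+x_{2m-3}x_{2m-2}+x_{2m-1}^2+bx_{2m}^2$ with $-b$ a nonsquare in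 $\mathbb{F}_q$ if $\varepsilon=-1$. Put $\beta(x,y)=Q(x+y)-Q(x)-Q(y)$. Graphs. $\mathrm{VO}^\varepsilon(2m,q)$ has vertex set $V$, distinct $u,w$ being adjacent iff $Q(u-w)=0$. $\mathrm{VNO}^\varepsilon(2m,q)$ has vertex set $V$, distinct $u,w$ being adjacent iff $Q(u-w)$ is a nonzero square in $\mathbb{F}_q$. Affine group. Elements of $\mathrm{AGL}(2m,q)$ are written $[M,u]$ with $M\in\mathrm{GL}(2m,q)$, $u\in V$, acting by $x^{[M,u]}=xM+u$, with product $[M_1,v_1][M_2,v_2]=[M_1M_2,v_1M_2+v_2]$. $\mathrm{SO}^\varepsilon(2m,q)$ is the group of determinant-1 matrices preserving $Q$. For a subspace $U\le V$, $T_U=\{[I,u]:u\in U\}$. The group $G_1^\varepsilon$. Let $v\in V$ with $Q(v)\neq 0$, let $v^\perp=\{u\in V:\beta(u,v)=0\}$, and let $H$ be an elementary abelian subgroup of order $q$ of the stabilizer of $\langle v\rangle$ in $\mathrm{SO}^\varepsilon(2m,q)$ (such $H$ exists, and every element of $H$ fixes $v$). Fix an isomorphism $(\mathbb{F}_q,+)\to H$, $\alpha\mapsto A_\alpha$. Set $\mathcal{A}=\{[A_\alpha,\alpha v]:\alpha\in\mathbb{F}_q\}$, an elementary abelian group of order $q$ normalizing $T_{v^\perp}$, and $G_1^\varepsilon=\langle T_{v^\perp},\mathcal{A}\rangle=T_{v^\perp}:\mathcal{A}$ (a semidirect product). *)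

(* Defs.v *)
From HB Require Import structures.
From mathcomp Require Import all_boot all_order all_fingroup all_algebra all_solvable.

Set Implicit Arguments.
Unset Strict Implicit.
Unset Printing Implicit Defensive.

Import GRing.Theory.
Local Open Scope ring_scope.

Section PartialDifferenceSets.

Variables (gT : finGroupType) (G : {group gT}).
Implicit Types (D : {set gT}) (g : gT).

Definition quotient_reps D g : nat :=
  #|[set d : gT * gT | [&& d.1 \in D, d.2 \in D & d.1 * d.2^-1 == g]%g]|.

Definition is_pds_with D (v k lambda mu : nat) : Prop :=
  [/\ D \subset G, #|G| = v, #|D| = k,
      forall g, g \in D -> g != 1%g -> quotient_reps D g = lambda
    & forall g, g \in G :\: D -> g != 1%g -> quotient_reps D g = mu].

(* The last two conditions say that the set is regular. *)
Definition is_pds D : Prop :=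
  exists v k lambda mu : nat,
    [/\ is_pds_with D v k lambda mu, 1%g \notin D & D^-1%g = D].

(* The vertex type subg_of G is the group G viewed as a type. *)
Definition Cay D : rel (subg_of G) :=
  fun x y => (sgval x * (sgval y)^-1)%g \in D.

End PartialDifferenceSets.

Arguments Cay {gT} G D.

Definition graph_iso (T1 T2 : finType) (e1 : rel T1) (e2 : rel T2) : Prop :=
  exists2 f : T1 -> T2, bijective f & forall x y, e2 (f x) (f y) = e1 x y.

(* MathComp's {'GL_n[F]} consists of matrices of size n.-1.+1, which is not
   convertible to n for a variable n; here the size is exactly n. *)
Section AffineGroup.

Variables (F : finFieldType) (n : nat).

Record gl := Gl { glmx :> 'M[F]_n; _ : glmx \in unitmx }.

HB.instance Definition _ := [isSub for glmx].
HB.instance Definition _ := [Finite of gl by <:].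

Lemma gl_unit (M : gl) : glmx M \in unitmx. Proof. exact: (valP M). Qed.

Lemma gl_mul_unit (M N : gl) : glmx M *m glmx N \in unitmx.
Proof. by rewrite unitmx_mul !gl_unit. Qed.

Lemma gl_inv_unit (M : gl) : invmx (glmx M) \in unitmx.
Proof. by rewrite unitmx_inv gl_unit. Qed.

Definition gl_one : gl := Gl (unitmx1 F n).
Definition gl_mul (M N : gl) : gl := Gl (gl_mul_unit M N).
Definition gl_inv (M : gl) : gl := Gl (gl_inv_unit M).

Lemma gl_mulA : associative gl_mul.
Proof. by move=> M N P; apply: val_inj; rewrite /= mulmxA. Qed.

Lemma gl_mul1 : left_id gl_one gl_mul.
Proof. by move=> M; apply: val_inj; rewrite /= mul1mx. Qed.

Lemma gl_mulV : left_inverse gl_one gl_inv gl_mul.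
Proof. by move=> M; apply: val_inj; rewrite /= mulVmx ?gl_unit. Qed.

HB.instance Definition _ := Finite_isGroup.Build gl gl_mulA gl_mul1 gl_mulV.

(* Agl M u is the affine map x |-> x *m M + u. *)
Record agl := Agl { agl_lin : gl; agl_trans : 'rV[F]_n }.

Definition pair_of_agl (g : agl) := (agl_lin g, agl_trans g).
Definition agl_of_pair (w : gl * 'rV[F]_n) := Agl w.1 w.2.

Lemma pair_of_aglK : cancel pair_of_agl agl_of_pair. Proof. by case. Qed.

HB.instance Definition _ := Finite.copy agl (can_type pair_of_aglK).

Definition agl_one : agl := Agl 1%g 0.

Definition agl_mul (g h : agl) : agl :=
  Agl (agl_lin g * agl_lin h)%g
      (agl_trans g *m agl_lin h + agl_trans h).

Definition agl_inv (g : agl) : agl :=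
  Agl (agl_lin g)^-1%g (- (agl_trans g *m ((agl_lin g)^-1)%g)).

Lemma agl_mulA : associative agl_mul.
Proof.
case=> [M1 v1] [M2 v2] [M3 v3]; rewrite /agl_mul /= mulgA.
by congr Agl; rewrite mulmxDl -mulmxA addrA.
Qed.

Lemma agl_mul1 : left_id agl_one agl_mul.
Proof. by case=> M v; rewrite /agl_mul /= mul1g mul0mx add0r. Qed.

Lemma agl_mulV : left_inverse agl_one agl_inv agl_mul.
Proof.
case=> M v; rewrite /agl_mul /= mulVg; congr Agl.
by rewrite mulNmx -mulmxA mulVmx ?gl_unit // mulmx1 addNr.
Qed.

HB.instance Definition _ :=
  Finite_isGroup.Build agl agl_mulA agl_mul1 agl_mulV.

Definition translations (U : {set 'rV[F]_n}) : {set agl} :=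
  [set Agl 1%g u | u in U].

End AffineGroup.

Definition is_square (F : finFieldType) (a : F) : bool :=
  [exists c : F, c ^+ 2 == a].

Inductive sign := Plus | Minus.

Section QuadraticSpace.

Variables (F : finFieldType) (m : nat) (eps : sign) (b : F).
Local Notation V := 'rV[F]_(m.*2).

Lemma fst_ord_proof (i : 'I_m) : (i.*2 < m.*2)%N.
Proof. by rewrite ltn_double. Qed.

Lemma snd_ord_proof (i : 'I_m) : (i.*2.+1 < m.*2)%N.
Proof. by rewrite ltn_Sdouble. Qed.

(* The indices of the i-th pair of coordinates: with i counted from 0 these
   are x_(2i+1) and x_(2i+2) in the usual numbering from 1. *)
Definition fst_ord (i : 'I_m) : 'I_(m.*2) := Ordinal (fst_ord_proof i).
Definition snd_ord (i : 'I_m) : 'I_(m.*2) := Ordinal (snd_ord_proof i).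

(* For eps = Minus the last pair contributes the anisotropic binary form
   x^2 + b y^2; for eps = Plus the scalar b is not used. *)
Definition Q (x : V) : F :=
  \sum_(i < m)
    let y := x 0 (fst_ord i) in
    let z := x 0 (snd_ord i) in
    match eps with
    | Plus => y * z
    | Minus => if i.+1 == m then y ^+ 2 + b * z ^+ 2 else y * z
    end.

Definition polar (x y : V) : F := Q (x + y) - Q x - Q y.

Definition perp (v : V) : {set V} := [set u | polar u v == 0].

Definition VO : rel V := fun u w => (u != w) && (Q (u - w) == 0).

Definition VNO : rel V :=
  fun u w => [&& u != w, Q (u - w) != 0 & is_square (Q (u - w))].

Definition SO : {set gl F m.*2} :=
  [set M : gl F m.*2 | (\det M == 1) && [forall x : V, Q (x *m M) == Q x]].

Definition SO_line_stab (v : V) : {set gl F m.*2} :=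
  [set M in SO | (v *m glmx M == v)%MS].

Definition calA (v : V) (A : F -> gl F m.*2) : {set agl F m.*2} :=
  [set Agl (A alpha) (alpha *: v) | alpha : F].

Definition G1 (v : V) (A : F -> gl F m.*2) : {group agl F m.*2} :=
  <<translations (perp v) :|: calA v A>>%G.

End QuadraticSpace.

Arguments VO {F} m eps b.
Arguments VNO {F} m eps b.

(* Main.v *)
Require Import Defs.
From HB Require Import structures.
From mathcomp Require Import all_boot all_order all_fingroup all_algebra all_solvable.
From mathcomp Require Import ring zify.

(** Project v orthogonally: each x in V is alpha v + u with u orthogonal to v,
    and alpha = vcoord x = beta(x, v) / beta(v, v).  Every A_alpha is an
    isometry fixing v, hence preserves vcoord, so the affine maps
    lift_vec x = [A_(vcoord x), x] are closed under multiplication; they make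
    up the group G_1, which therefore acts regularly on V.  Moreover

      lift_vec x * (lift_vec y)^-1 = lift_vec ((x - y) A_(- vcoord y)),

    so for a symmetric set X of vectors invariant under the A_alpha, such as a
    union of level sets of Q, the Cayley graph of G_1 on the lift of X is the
    Cayley graph of (V, +) on X, and counting representations in G_1 reduces to
    counting the x in X with w - x in X (the number conv X X w).  The lifts of
    the nonzero singular vectors, of the vectors of nonsquare norm and of the
    vectors of nonzero square norm are D0, D1 and D2 (G1_lift,
    graph_iso_Cay, quotient_reps_conv).  G_1 is not abelian because A_1
    acts nontrivially on v^perp.

    It remains to see that conv X X takes one value on the nonzero vectors of X
    and one value off X, for each of the three level sets X (two_valued).
    In odd characteristic this holds for every nondegenerate quadratic form q
    having a similarity sigma with a nonsquare multiplier.  The standard forms have one: scale one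
    vector of each hyperbolic pair, and multiply by an element of nonsquare
    norm of the quadratic extension on the anisotropic pair
    (nonsquare_similarity).

    - By reflections and homotheties, conv is constant on the vectors of nonzero
      square norm and on those of nonsquare norm (conv_nonsingular); sigma
      exchanges these two classes.
    - At a singular w, translation along w shows that the values of
      (q x, q (w - x)) with distinct entries are equidistributed
      (conv_singular), which gives conv explicitly there.

    For the singular level set this suffices.  For the set X of nonzero square
    norms, write a for conv X X at nonsquare norm and c for conv X X at a
    singular vector.  Counting triangles in two ways expresses a through |X|;
    a = c then amounts to a quadratic equation for the number r of vectors of
    a given nonzero norm, (|F| r - |V|)^2 = |V|
    (norm_fiber_square_eq, conv_sq_arith).  It is obtained by
    counting the pairs with q x = q y, which (x, y) |-> (x + y, x - y) turns into
    the orthogonal pairs.  The sign of the form never enters, and sigma carries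
    the result over to nonsquare norms. *)

Set Implicit Arguments.
Unset Strict Implicit.
Unset Printing Implicit Defensive.

Import GRing.Theory.
Local Open Scope ring_scope.

(** * Counting in finite sets *)

Lemma card_fibers (T R : finType) (f : T -> R) (A : {set T}) :
  #|A| = (\sum_d #|[set x in A | f x == d]|)%N.
Proof.
rewrite -sum1_card (partition_big f predT) //=; apply: eq_bigr => d _.
by rewrite -sum1_card; apply: eq_bigl => x; rewrite inE.
Qed.

Lemma card_eq_inj (T : finType) (g : T -> T) (A B : {set T}) :
  injective g -> (forall x, (g x \in B) = (x \in A)) -> #|A| = #|B|.
Proof.
move=> g_inj gAB; rewrite -(card_preimset B g_inj).
by apply: eq_card => x; rewrite inE gAB.
Qed.

(** * Squares in a finite field of odd characteristic *)

Section Squares.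

Variable F : finFieldType.
Implicit Types a c : F.

Lemma is_squareP a : reflect (exists c, a = c ^+ 2) (is_square a).
Proof.
by apply: (iffP existsP) => -[c]; [move/eqP|move=> ->]; exists c.
Qed.

Lemma is_square_sqr c : is_square (c ^+ 2).
Proof. by apply/is_squareP; exists c. Qed.

Lemma is_square0 : is_square (0 : F).
Proof. by apply/is_squareP; exists 0; rewrite expr0n. Qed.

Lemma is_square1 : is_square (1 : F).
Proof. by apply/is_squareP; exists 1; rewrite expr1n. Qed.

Definition nzsquares : {set F} := [set a | (a != 0) && is_square a].
Definition nonsquares : {set F} := [set a | ~~ is_square a].

Lemma nonsquare_neq0 a : ~~ is_square a -> a != 0.
Proof. by apply: contraNneq => ->; exact: is_square0. Qed.

Lemma is_squareMl c a : c != 0 -> is_square (c ^+ 2 * a) = is_square a.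
Proof.
move=> c0; apply/is_squareP/is_squareP => -[d].
  by move=> e; exists (d / c); rewrite exprMn exprVn -e mulrC mulKf ?expf_neq0.
by move=> ->; exists (c * d); rewrite exprMn.
Qed.

Lemma disjoint_zero_nonsquares : [disjoint [set 0] & nonsquares].
Proof. by rewrite disjoints1 inE is_square0. Qed.

Lemma disjoint_zero_nzsquares : [disjoint [set 0] & nzsquares].
Proof. by rewrite disjoints1 inE eqxx. Qed.

Lemma disjoint_nonsquares_nzsquares : [disjoint nonsquares & nzsquares].
Proof.
by rewrite -setI_eq0; apply/eqP/setP=> a; rewrite !inE andbCA andNb andbF.
Qed.

Hypothesis two_neq0 : 2%:R != 0 :> F.

(** Squaring is two-to-one on the nonzero elements. *)
Lemma card_nzsquares : (#|nzsquares|).*2.+1 = #|F|.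
Proof.
pose P : {set F} := [set c | c != 0].
have -> : #|F| = #|P|.+1.
  rewrite -cardsT (cardsD1 0) inE add1n; congr _.+1.
  by apply: eq_card => x; rewrite !inE andbT.
congr _.+1; rewrite (card_fibers (fun c => c ^+ 2) P).
rewrite (bigID (mem nzsquares)) /= [X in (_ + X)%N]big1 ?addn0.
  rewrite -muln2 -sum_nat_const; apply: eq_bigr => a.
  rewrite inE => /andP[a0 /is_squareP[c ac]]; rewrite ac in a0 *.
  have c0 : c != 0 by apply: contraNneq a0 => ->; rewrite expr0n.
  rewrite (_ : [set x in P | _] = [set c; - c]) ?cards2.
    rewrite -subr_eq0 opprK -mulr2n -mulr_natl mulf_eq0 (negPf c0) orbF.
    by rewrite two_neq0.
  apply/setP=> x; rewrite !inE eqf_sqr andb_idl //.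
  by case/orP=> /eqP->; rewrite ?oppr_eq0.
move=> a; rewrite inE negb_and negbK => na; apply/eqP; rewrite cards_eq0.
apply/eqP/setP=> c; rewrite !inE; apply/negP=> /andP[c0 /eqP ca].
by move: na; rewrite -ca is_square_sqr expf_eq0 (negPf c0).
Qed.

Lemma card_nonsquares : #|nonsquares| = #|nzsquares|.
Proof.
have := card_nzsquares; rewrite -(cardsC nzsquares).
have -> : ~: nzsquares = 0 |: nonsquares.
  apply/setP=> a; rewrite !inE negb_and negbK; congr orb.
rewrite cardsU1 inE is_square0 /=; lia.
Qed.

Lemma nonsquare_exists : exists a : F, ~~ is_square a.
Proof.
suff : (0 < #|nonsquares|)%N by case/card_gt0P=> a; rewrite inE; exists a.
rewrite card_nonsquares.
by apply/card_gt0P; exists 1; rewrite inE oner_neq0 is_square1.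
Qed.

(** Multiplication by a nonsquare injects the nonzero squares into the
    nonsquares, hence, both sets having the same size, onto them. *)
Lemma is_squareM_nonsquare a c :
  ~~ is_square a -> is_square (a * c) = (c == 0) || ~~ is_square c.
Proof.
move=> nsa; have a0 := nonsquare_neq0 nsa.
have [->|c0 /=] := eqVneq c 0; first by rewrite mulr0 is_square0.
apply/idP/idP => [|nsc].
  apply: contraL => /is_squareP[d cd]; rewrite cd in c0 *.
  by rewrite mulrC is_squareMl //; apply: contraNneq c0 => ->; rewrite expr0n.
have sub : [set a * x | x in nzsquares] \subset nonsquares.
  apply/subsetP=> _ /imsetP[x + ->]; rewrite !inE => /andP[x0 /is_squareP[d xd]].
  rewrite mulrC xd is_squareMl //.
  by apply: contraNneq x0 => d0; rewrite xd d0 expr0n.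
have := subset_leqif_cards sub.
rewrite card_imset; last exact: (mulfI a0).
rewrite card_nonsquares => -[_]; rewrite eqxx => /esym/eqP im.
have : c \in nonsquares by rewrite inE.
rewrite -im => /imsetP[x + ->]; rewrite inE => /andP[_ sx].
by rewrite mulrA -expr2 is_squareMl.
Qed.

End Squares.

(** * Nondegenerate quadratic forms *)

Definition pol (F : finFieldType) n (q : 'rV[F]_n -> F) (x y : 'rV[F]_n) : F :=
  q (x + y) - q x - q y.

(** Only additivity and homogeneity of the polar form on the left are recorded;
    the right side follows by symmetry. *)
Record nondeg_quadratic (F : finFieldType) n (q : 'rV[F]_n -> F) : Prop :=
  NondegQuadratic {
    quadZ : forall a x, q (a *: x) = a ^+ 2 * q x;
    polDl : forall x y z, pol q (x + y) z = pol q x z + pol q y z;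
    polZl : forall a x z, pol q (a *: x) z = a * pol q x z;
    pol_nondeg : forall w, w != 0 -> exists z, pol q z w != 0
  }.

Definition similarity (F : finFieldType) n (q : 'rV[F]_n -> F) (c : F)
    (s : 'rV[F]_n -> 'rV[F]_n) : Prop :=
  [/\ {morph s : x y / x - y}, injective s & forall x, q (s x) = c * q x].

Section QuadraticForm.

Variables (F : finFieldType) (n : nat) (q : 'rV[F]_n -> F).
Local Notation V := 'rV[F]_n.
Local Notation B := (pol q).
Hypothesis two_neq0 : 2%:R != 0 :> F.
Hypothesis q_nondeg : nondeg_quadratic q.
Implicit Types (x y z u w : V) (S T : {set F}) (X Y Z : {set V}).

Let qZ := quadZ q_nondeg.
Let BDl := polDl q_nondeg.
Let BZl := polZl q_nondeg.

Lemma polC x y : B x y = B y x.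
Proof. by rewrite /pol (addrC y x); ring. Qed.

Lemma polDr x y z : B x (y + z) = B x y + B x z.
Proof. by rewrite polC BDl !(polC x). Qed.

Lemma polZr a x z : B x (a *: z) = a * B x z.
Proof. by rewrite polC BZl polC. Qed.

Lemma polNl x z : B (- x) z = - B x z.
Proof. by rewrite -scaleN1r BZl mulN1r. Qed.

Lemma polNr x z : B x (- z) = - B x z.
Proof. by rewrite polC polNl polC. Qed.

Lemma quadD x y : q (x + y) = q x + q y + B x y.
Proof. by rewrite /pol; ring. Qed.

Lemma quad0 : q 0 = 0.
Proof. by rewrite -(scale0r 0) qZ expr0n mul0r. Qed.

Lemma quadN x : q (- x) = q x.
Proof. by rewrite -scaleN1r qZ sqrrN expr1n mul1r. Qed.

Lemma quadB x y : q (x - y) = q x + q y - B x y.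
Proof. by rewrite quadD quadN polNr. Qed.

Lemma polxx x : B x x = 2%:R * q x.
Proof.
by rewrite /pol -mulr2n -scaler_nat qZ; ring.
Qed.

Lemma card_V : #|[set: V]| = (#|F| ^ n)%N.
Proof. by rewrite cardsT card_mx mul1n. Qed.

(** The values of a nonzero linear form are equidistributed, since translating
    by multiples of a vector off its kernel permutes its fibres. *)
Lemma card_hyperplane w d : w != 0 ->
  (#|[set x | B x w == d]| * #|F| = #|F| ^ n)%N.
Proof.
move=> /(pol_nondeg q_nondeg)[z Bz].
rewrite -card_V (card_fibers (B^~ w) setT) mulnC -sum_nat_const.
apply: eq_big => // c _.
apply: (@card_eq_inj _ (fun x : V => x + ((c - d) / B z w) *: z)).
  exact: addIr.
by move=> x; rewrite !inE BDl BZl divfK // -subr_eq0 -[RHS]subr_eq0; congr (_ == _); ring.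
Qed.

(** For singular w, moving x along w changes q x by multiples of B x w while
    preserving B x w; so q is equidistributed on each hyperplane B x w = d
    with d nonzero. *)
Lemma card_singular_slice w a c : w != 0 -> q w = 0 -> a != c ->
  (#|[set x | (q x == a) && (q (w - x) == c)]| * #|F| ^ 2 = #|F| ^ n)%N.
Proof.
move=> w0 qw ac.
rewrite -(card_hyperplane (a - c) w0) expnS expn1 mulnA; congr (_ * _)%N.
rewrite (card_fibers q [set x | B x w == _]) mulnC -sum_nat_const.
apply: eq_big => // a' _.
have d0 : a - c != 0 by rewrite subr_eq0.
apply: (@card_eq_inj _ (fun x : V => x + ((a' - a) / (a - c)) *: w)); first exact: addIr.
move=> x; rewrite !inE BDl BZl polxx qw mulr0 mulr0 addr0.
rewrite quadD qZ qw mulr0 addr0 polZr quadB qw add0r (polC w).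
apply/andP/andP => -[/eqP h1 /eqP h2].
  rewrite h1 in h2 *.
  rewrite divfK // in h2.
  have qx : q x = a by rewrite -[q x](addrK (a' - a)) h2; ring.
  by rewrite qx subKr !eqxx.
rewrite h1; have -> : B x w = a - c by rewrite -h2 h1; ring.
by rewrite divfK // [a + (_ - a)]addrC subrK !eqxx.
Qed.

Lemma similarityZ t : t != 0 -> similarity q (t ^+ 2) (fun x => t *: x).
Proof.
move=> t0; split; last exact: qZ.
  by move=> x y; rewrite scalerBr.
exact: (can_inj (scalerK t0)).
Qed.

Lemma similarity_comp c d s t :
  similarity q c s -> similarity q d t -> similarity q (c * d) (s \o t).
Proof.
move=> [sB s_inj qs] [tB t_inj qt]; split; last by move=> x /=; rewrite qs qt mulrA.
  by move=> x y /=; rewrite tB sB.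
exact: inj_comp.
Qed.

(** The reflection in the hyperplane orthogonal to z; since B z z = 2 q z, the
    usual factor 2 is absorbed by q z. *)
Definition refl z x : V := x - (B x z / q z) *: z.

Lemma similarity_refl z : q z != 0 -> similarity q 1 (refl z).
Proof.
move=> qz0; split.
- move=> x y; rewrite /refl BDl polNl mulrBl scalerBl.
  by rewrite !opprB [_ *: z - _]addrC addrACA (addrC (- y)).
- apply: (can_inj (g := refl z)) => x; rewrite /refl BDl polNl BZl polxx.
  rewrite -addrA -opprD -scalerDl.
  have -> : B x z / q z + (B x z - B x z / q z * (2%:R * q z)) / q z = 0 by field.
  by rewrite scale0r subr0.
- move=> x; rewrite /refl quadB qZ polZr mul1r; field.
  exact: qz0.
Qed.

Lemma similarityN : similarity q 1 (fun x => - x).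
Proof.
split; last by move=> x; rewrite quadN mul1r.
  by move=> x y; rewrite opprD.
exact: oppr_inj.
Qed.

(** If q u = q w, then q (u - w) + q (u + w) = 4 q u; so the reflection in
    u - w, or the reflection in u + w followed by -1, moves u to w. *)
Lemma isometry_transitive u w : q u != 0 -> q u = q w ->
  exists2 s, similarity q 1 s & s u = w.
Proof.
move=> qu0 quw.
have [qd|qd] := eqVneq (q (u - w)) 0.
  have Buw : B u w = q u + q u by move/eqP: qd; rewrite quadB -quw subr_eq0 => /eqP <-.
  have qs : q (u + w) = 2%:R * 2%:R * q u by rewrite quadD Buw -quw; ring.
  have qs0 : q (u + w) != 0 by rewrite qs !mulf_neq0.
  exists ((fun x => - x) \o refl (u + w)).
    by rewrite -(mulr1 1); apply: similarity_comp similarityN (similarity_refl qs0).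
  rewrite /= /refl polDr polxx Buw qs.
  rewrite (_ : _ / _ = 1) ?scale1r; last by field; rewrite qu0 (natrM _ 2 2) mulf_neq0.
  by rewrite opprB addrC addKr.
exists (refl (u - w)); first exact: similarity_refl.
rewrite /refl (_ : _ / _ = 1) ?scale1r ?subKr //.
rewrite -[RHS](divff qd); congr (_ / _).
by rewrite quadB polDr polNr polxx -quw; ring.
Qed.

Lemma similarity0 c s : similarity q c s -> s 0 = 0.
Proof. by case=> sB _ _; rewrite -[0 in LHS](subrr 0) sB subrr. Qed.

Lemma similarity_eq0 c s x : similarity q c s -> (s x == 0) = (x == 0).
Proof.
by move=> ss; rewrite -{1}(similarity0 ss); case: ss => _ s_inj _; rewrite inj_eq.
Qed.

(** The value at w of the convolution of the indicator functions of X and Y. *)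
Definition conv X Y w := #|[set x in X | w - x \in Y]|.

(** The zero vector is always left out, so that the level sets partition the
    nonzero vectors even when S contains 0. *)
Definition level S : {set V} := [set x | (x != 0) && (q x \in S)].

Lemma conv_sum X Y w : conv X Y w = (\sum_(x in X) ((w - x)%R \in Y))%N.
Proof.
rewrite /conv -sum1_card big_mkcond /= [RHS]big_mkcond /=.
by apply: eq_bigr => x _; rewrite inE; case: (x \in X); case: (_ \in Y).
Qed.

Lemma convC X Y w : conv X Y w = conv Y X w.
Proof.
apply: (@card_eq_inj _ (fun x : V => w - x)); first exact: (can_inj (subKr w)).
by move=> x; rewrite !inE subKr andbC.
Qed.

(** Both sides count the pairs (w, x) in Z * X with w - x in Y. *)
Lemma sum_conv X Y Z : (forall x, (- x \in Y) = (x \in Y)) ->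
  (\sum_(w in Z) conv X Y w = \sum_(x in X) conv Z Y x)%N.
Proof.
move=> YN; rewrite (eq_bigr _ (fun w _ => conv_sum X Y w)) exchange_big /=.
apply: eq_bigr => x _; rewrite conv_sum; apply: eq_bigr => w _.
by rewrite -YN opprB.
Qed.

Lemma levelN S x : (- x \in level S) = (x \in level S).
Proof. by rewrite !inE oppr_eq0 quadN. Qed.

Lemma mem_level_similarity c s S S' x : similarity q c s ->
  (forall a, (c * a \in S') = (a \in S)) -> (s x \in level S') = (x \in level S).
Proof.
by move=> ss SS; rewrite !inE (similarity_eq0 x ss); case: ss => _ _ ->; rewrite SS.
Qed.

Lemma card_level_similarity c s S S' : similarity q c s ->
  (forall a, (c * a \in S') = (a \in S)) -> #|level S'| = #|level S|.
Proof.
move=> ss SS; apply/esym; apply: (@card_eq_inj _ s); first by case: ss.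
by move=> x; apply: mem_level_similarity ss SS.
Qed.

Lemma conv_similarity c s S S' T T' w : similarity q c s ->
  (forall a, (c * a \in S') = (a \in S)) ->
  (forall a, (c * a \in T') = (a \in T)) ->
  conv (level S') (level T') (s w) = conv (level S) (level T) w.
Proof.
move=> ss SS TT; apply/esym; apply: (@card_eq_inj _ s); first by case: ss.
move=> x; rewrite !(inE, in_setI) -/(level _).
have sB : s w - s x = s (w - x) by case: ss => ->.
rewrite sB.
have := mem_level_similarity x ss SS; have := mem_level_similarity (w - x) ss TT.
by rewrite !inE => -> ->.
Qed.

(** For disjoint S and T the slice lemma applies to each pair of values. *)
Lemma conv_singular S T w : w != 0 -> q w = 0 -> [disjoint S & T] ->
  (conv (level S) (level T) w * #|F| ^ 2 = #|S| * #|T| * #|F| ^ n)%N.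
Proof.
move=> w0 qw dST; rewrite /conv (card_fibers (fun x => (q x, q (w - x)))) big_distrl /=.
rewrite -cardsX -sum_nat_const [RHS]big_mkcond /=; apply: eq_bigr => -[a c] _.
rewrite inE /=; case: ifP => [/andP[aS cT]|ac]; last first.
  apply/eqP; rewrite muln_eq0 cards_eq0; apply/orP; left; apply/eqP/setP=> x.
  rewrite !inE; apply/negP=> /andP[/andP[/andP[_ h1] /andP[_ h2]]] /eqP[e1 e2].
  by move: ac; rewrite -e1 -e2 h1 h2.
have ac : a != c by apply: contraTneq aS => ->; rewrite (disjointFl dST).
rewrite -(card_singular_slice w0 qw ac); congr (_ * _)%N.
apply: eq_card => x; rewrite !inE xpair_eqE andb_idl //.
case/andP=> /eqP qx /eqP qwx; rewrite qx qwx aS cT !andbT; apply/andP; split.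
  by apply: contraNneq ac => x0; rewrite -qx -qwx x0 subr0 qw quad0.
apply: contraNneq ac => /eqP; rewrite subr_eq0 => /eqP wx.
by rewrite -qx -qwx -wx subrr qw quad0.
Qed.

End QuadraticForm.

(** * The three level sets have two-valued convolution squares *)

(** The partial difference set condition on X, for the group (V, +). *)
Definition two_valued (F : finFieldType) n (X : {set 'rV[F]_n}) : Prop :=
  forall u w, u != 0 -> w != 0 -> (u \in X) = (w \in X) ->
  conv X X u = conv X X w.

(** With q = |F|, N = |V|, s the number of nonzero squares, r the number of
    vectors of a given nonzero norm, k and k0 the numbers of vectors of nonzero
    square norm and of nonzero singular vectors: h, p, c count the x of square
    norm whose difference from a singular vector is singular, of nonsquare, or
    of square norm, and a is the analogue of c for a vector of nonsquare norm.
    The equation in r amounts to (q r - N)^2 = N, and the one in a comes from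
    counting triangles; eliminating h and p,
    4 k q^2 (c - a) = 2 s^2 ((q r - N)^2 - N). *)
Lemma conv_sq_arith (q N s r k k0 h p c a : nat) :
  (s.*2.+1 = q -> N = k0 + k + k + 1 -> k = s * r ->
   q * (k0 + 1) ^ 2 + q * (q - 1) * r ^ 2 = q * N + (N - 1) * N ->
   k = h + p + c -> h * q ^ 2 = s * N -> p * q ^ 2 = s * s * N ->
   k * k = k0 * p + k * a + k * a -> 0 < k -> c = a)%N.
Proof.
move=> Eq EN Ek Er Esum Eh Ep Ea k_gt0.
have N1 : (N - 1 = k0 + k + k)%N by lia.
have q1 : (q - 1 = s + s)%N by lia.
rewrite {}N1 {}q1 in Er.
apply/eqP; rewrite -(@eqn_pmul2l (4 * k * q ^ 2)); last first.
  by rewrite -Eq !muln_gt0 k_gt0.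
have P1 := congr1 (muln (4 * k * q ^ 2)) Esum.
have P2 := congr1 (muln (4 * k)) Eh.
have P3 := congr1 (muln (4 * k)) Ep.
have P4 := congr1 (muln (2 * q ^ 2)) Ea.
have P5 := congr1 (muln (2 * k0)) Ep.
have P6 := congr1 (muln s) Er.
apply/eqP.
have cancel (x y u w : nat) : u = w -> (x + u = y + w)%N -> x = y by lia.
(* The multiple 4 k q^2 (c - a) is a combination of the six equations; add them
   up with the right signs and compare the resulting polynomials. *)
apply: (cancel _ _ _ _ (congr2 addn P1 (congr2 addn P2 (congr2 addn P3 
  (congr2 addn (esym P4) (congr2 addn (esym P5) (esym P6))))))).
clear -Ek EN Eq.
rewrite EN Ek -Eq -mul2n -addn1; clear.
ring.
Qed.

Section TwoValued.

Variables (F : finFieldType) (n : nat) (q : 'rV[F]_n -> F).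
Local Notation V := 'rV[F]_n.
Local Notation B := (pol q).
Hypothesis two_neq0 : 2%:R != 0 :> F.
Hypothesis q_nondeg : nondeg_quadratic q.
Variables (eta : F) (sigma : V -> V).
Hypothesis eta_nonsquare : ~~ is_square eta.
Hypothesis sigma_sim : similarity q eta sigma.
Implicit Types (x y z u w : V) (S T : {set F}) (X Y Z : {set V}).

Local Notation singular := (level q [set 0]).
Local Notation nonsq := (level q (nonsquares F)).
Local Notation sq := (level q (nzsquares F)).

Let qZ := quadZ q_nondeg.

Lemma mem_singular x : (x \in singular) = (x != 0) && (q x == 0).
Proof. by rewrite !inE. Qed.

Lemma mem_nonsq x : (x \in nonsq) = ~~ is_square (q x).
Proof.
rewrite !inE andb_idl // => /nonsquare_neq0.
by apply: contraNneq => ->; rewrite (quad0 q_nondeg).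
Qed.

Lemma mem_sq x : (x \in sq) = (q x != 0) && is_square (q x).
Proof.
rewrite !inE andb_idl // => /andP[+ _].
by apply: contraNneq => ->; rewrite (quad0 q_nondeg).
Qed.

(** Exactly one of the four cases holds; as a sum, this can be summed over x. *)
Lemma level_cases x :
  ((x == 0%R) + (x \in singular) + (x \in nonsq) + (x \in sq) = 1)%N.
Proof.
rewrite mem_singular mem_nonsq mem_sq.
have [->|x0] := eqVneq x 0; first by rewrite (quad0 q_nondeg) is_square0 eqxx.
by have [->|qx0] := eqVneq (q x) 0; rewrite ?is_square0 //=; case: is_square.
Qed.

Lemma card_conv_partition X w :
  (#|X| = conv X singular w + conv X nonsq w + conv X sq w + (w \in X))%N.
Proof.
rewrite !conv_sum -sum1_card -big_split -big_split /=.
have -> : (w \in X : nat) = (\sum_(x in X) (w - x == 0)%R)%N.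
  rewrite big_mkcond /= (bigD1 w) //= subrr eqxx big1 ?addn0; first by case: (w \in X).
  by move=> x xw; case: ifP => // _; rewrite subr_eq0 eq_sym (negPf xw).
rewrite -big_split; apply: eq_bigr => x _.
by rewrite -[LHS](level_cases (w - x)) [RHS]addnC !addnA.
Qed.

Lemma card_level_partition :
  (#|F| ^ n = #|singular| + #|nonsq| + #|sq| + 1)%N.
Proof.
rewrite -card_V -sum1_card (eq_bigr _ (fun x _ => esym (level_cases x))) /=.
rewrite !big_split /= -!sum1_card.
have hsum (X : {set V}) : (\sum_(x in [set: V]) (x \in X) = \sum_(x in X) 1)%N.
  rewrite big_mkcond [RHS]big_mkcond; apply: eq_bigr => x _; rewrite inE.
  by case: (x \in X).
rewrite !hsum (bigD1 0) ?inE //= eqxx big1 ?addn0; last by move=> x /andP[_ /negPf->].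
by rewrite add1n; lia.
Qed.

Definition square_stable S :=
  forall t a, t != 0 -> (t ^+ 2 * a \in S) = (a \in S).

Lemma square_stable0 : square_stable [set 0].
Proof. by move=> t a t0; rewrite !inE mulf_eq0 expf_eq0 (negPf t0). Qed.

Lemma square_stable_nzsquares : square_stable (nzsquares F).
Proof. by move=> t a t0; rewrite !inE is_squareMl // mulf_eq0 expf_eq0 (negPf t0). Qed.

(** Vectors whose norms are nonzero and differ by a square factor are related
    by a homothety followed by an isometry. *)
Lemma conv_nonsingular S T u w : square_stable S -> square_stable T ->
  q u != 0 -> q w != 0 -> is_square (q u) = is_square (q w) ->
  conv (level q S) (level q T) u = conv (level q S) (level q T) w.
Proof.
move=> sS sT qu0 qw0 uw.
have [t qw] : exists t, q u * q w = t ^+ 2.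
  apply/is_squareP; have [su|nsu] := boolP (is_square (q u)).
    have /is_squareP[c cu] := su; rewrite cu is_squareMl -?uw //.
    by apply: contraNneq qu0 => c0; rewrite cu c0 expr0n.
  by rewrite is_squareM_nonsquare // -uw nsu orbT.
have t0 : t != 0.
  by have := mulf_neq0 qu0 qw0; rewrite qw expf_eq0.
have r0 : t / q u != 0 by rewrite mulf_neq0 ?invr_eq0.
have [|| s ss suw] :=
  isometry_transitive two_neq0 q_nondeg (u := (t / q u) *: u) (w := w).
- by rewrite qZ mulf_neq0 // expf_eq0.
- rewrite qZ exprMn exprVn -qw; field; exact: qu0.
rewrite -suw (conv_similarity (S := S) (T := T) _ ss) => [|a|a]; rewrite ?mul1r //.
rewrite (conv_similarity (S := S) (T := T) _ (similarityZ q_nondeg r0)) //.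
- by move=> a; rewrite sS.
- by move=> a; rewrite sT.
Qed.

Lemma eta_zero a : (eta * a \in [set 0]) = (a \in [set 0]).
Proof. by rewrite !inE mulf_eq0 (negPf (nonsquare_neq0 eta_nonsquare)). Qed.

Lemma eta_nzsquares a : (eta * a \in nzsquares F) = (a \in nonsquares F).
Proof.
rewrite !inE mulf_eq0 (negPf (nonsquare_neq0 eta_nonsquare)) /= is_squareM_nonsquare //.
have [->|//] := eqVneq a 0; by rewrite is_square0.
Qed.

Lemma eta_nonsquares a : (eta * a \in nonsquares F) = (a \in nzsquares F).
Proof. by rewrite !inE is_squareM_nonsquare // negb_or negbK. Qed.

Lemma card_nonsq : #|nonsq| = #|sq|.
Proof. exact: (card_level_similarity sigma_sim eta_nonsquares). Qed.

Lemma conv_sigma_sq w : conv sq sq (sigma w) = conv nonsq nonsq w.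
Proof. exact: (conv_similarity w sigma_sim eta_nzsquares eta_nzsquares). Qed.

(** Homotheties compare norms that differ by a square factor, and sigma compares
    square norms with nonsquare ones. *)
Lemma card_norm_fiber a : a != 0 -> #|[set x | q x == a]| = #|[set x | q x == 1]|.
Proof.
have scale c t : t != 0 -> #|[set x | q x == c]| = #|[set x | q x == t ^+ 2 * c]|.
  move=> t0; apply: (@card_eq_inj _ (fun x : V => t *: x)).
    exact: (can_inj (scalerK t0)).
  by move=> x; rewrite !inE qZ (inj_eq (mulfI _)) // expf_neq0.
move=> a0; have [/is_squareP[t at2]|nsa] := boolP (is_square a).
  rewrite at2 in a0 *; rewrite (scale 1 t) ?mulr1 //.
  by apply: contraNneq a0 => ->; rewrite expr0n.
have eta0 := nonsquare_neq0 eta_nonsquare.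
have -> : #|[set x | q x == 1]| = #|[set x | q x == eta]|.
  apply: (@card_eq_inj _ sigma); first by case: sigma_sim.
  case: sigma_sim => _ _ qs x; rewrite !inE qs -{2}(mulr1 eta).
  by rewrite (inj_eq (mulfI _)).
have /is_squareP[t e] : is_square (eta * a) by rewrite is_squareM_nonsquare // nsa orbT.
have t0 : t != 0 by have := mulf_neq0 eta0 a0; rewrite e expf_eq0.
rewrite (scale eta (t / eta)) ?mulf_neq0 ?invr_eq0 //.
have -> // : (t / eta) ^+ 2 * eta = a by rewrite exprMn exprVn -e; field.
Qed.

Lemma card_sq : #|sq| = (#|nzsquares F| * #|[set x | q x == 1%R]|)%N.
Proof.
rewrite (card_fibers q sq) -sum_nat_const [RHS]big_mkcond /=; apply: eq_bigr => a _.
have [aS|aS] := boolP (a \in nzsquares F); last first.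
  apply/eqP; rewrite cards_eq0; apply/eqP/setP=> x; rewrite !inE.
  by apply/negP=> /andP[/andP[_ +] /eqP qx]; rewrite qx; move: aS; rewrite inE => /negP.
have a0 : a != 0 by move: aS; rewrite inE => /andP[].
rewrite -(card_norm_fiber a0); apply: eq_card => x.
rewrite inE mem_sq [RHS]inE andb_idl // => /eqP->.
by move: aS; rewrite inE.
Qed.

(** The pairs with q x = q y correspond, through (x, y) |-> (x + y, x - y), to
    the orthogonal pairs. *)
Lemma card_isonorm_pairs :
  #|[set p : V * V | q p.1 == q p.2]| = #|[set p : V * V | B p.1 p.2 == 0]|.
Proof.
pose g (p : V * V) := (p.1 + p.2, p.1 - p.2).
apply: (@card_eq_inj _ g).
  move=> [x y] [x' y']; rewrite /g /= => -[e1 e2].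
  have h (a b : V) : a *+ 2 = b *+ 2 -> a = b.
    by rewrite -!scaler_nat; apply: (can_inj (scalerK two_neq0)).
  have h1 (a b : V) : (a + b) + (a - b) = a *+ 2 by rewrite addrACA subrr addr0.
  have h2 (a b : V) : (a + b) - (a - b) = b *+ 2 by rewrite opprB addrC addrA subrK.
  congr pair; apply: h; first by rewrite -(h1 _ y) e1 e2 h1.
  by rewrite -(h2 x) e1 e2 h2.
case=> x y; rewrite !inE /g /= polDl // !polDr // !polNr //.
rewrite !polxx // (polC q y x).
have -> : 2%:R * q x - B x y + (B x y - 2%:R * q y) = 2%:R * (q x - q y) by ring.
by rewrite mulf_eq0 (negPf two_neq0) /= subr_eq0.
Qed.

(** Both sides are |F| times the number of pairs (x, y) with q x = q y, first
    sorted by their common norm, then counted as orthogonal pairs.  Since the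
    norm 0 is attained |F|^n - (|F| - 1) r times, where r is the size of the
    fibre of norm 1, this is a quadratic equation for r. *)
Lemma norm_fiber_square_eq :
  (#|F| * #|[set x | q x == 0%R]| ^ 2 +
   #|F| * (#|F| - 1) * #|[set x | q x == 1%R]| ^ 2 =
   #|F| * #|F| ^ n + (#|F| ^ n - 1) * #|F| ^ n)%N.
Proof.
have sq_sum : #|[set p : V * V | q p.1 == q p.2]| =
    (#|[set x | q x == 0%R]| ^ 2 + (#|F| - 1) * #|[set x | q x == 1%R]| ^ 2)%N.
  rewrite (card_fibers (fun p : V * V => q p.1)).
  have fib a : #|[set p in [set p : V * V | q p.1 == q p.2] | q p.1 == a]| =
      (#|[set x | q x == a]| ^ 2)%N.
    rewrite expnS expn1 -cardsX; apply: eq_card => -[x y]; rewrite !inE /=.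
    by apply/andP/andP => -[/eqP e1 /eqP e2]; rewrite -?e1 -?e2 ?e1 ?e2 !eqxx.
  rewrite (bigD1 0) //= fib; congr (_ + _)%N.
  under eq_bigr => a a0 do rewrite fib card_norm_fiber //.
  rewrite sum_nat_const; congr (_ * _)%N.
  by have := cardC1 (0 : F); rewrite -subn1 => <-.
have orth_sum : (#|F| * #|[set p : V * V | B p.1 p.2 == 0%R]| =
    #|F| * #|F| ^ n + (#|F| ^ n - 1) * #|F| ^ n)%N.
  rewrite (card_fibers (fun p : V * V => p.2)).
  have fib w : #|[set p in [set p : V * V | B p.1 p.2 == 0] | p.2 == w]| =
      #|[set x | B x w == 0]|.
    rewrite -(card_imset _ (f := fun x : V => (x, w))); last by move=> x y [].
    apply: eq_card => -[x y]; rewrite !inE /=.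
    apply/andP/imsetP => [[e1 /eqP e2]|[z + [-> ->]]].
      by exists x; rewrite ?inE -?e2.
    by rewrite inE.
  rewrite big_distrr /= (bigD1 0) //= fib; congr (_ + _)%N.
    congr (_ * _)%N; rewrite -card_V; apply: eq_card => x; rewrite !inE.
    by rewrite -(scale0r 0) polZr // mul0r eqxx.
  under eq_bigr => w w0 do rewrite fib mulnC card_hyperplane //.
  rewrite sum_nat_const; congr (_ * _)%N.
  by have := cardC1 (0 : V); rewrite -card_V cardsT -subn1 => <-.
rewrite -orth_sum -card_isonorm_pairs sq_sum; lia.
Qed.

Lemma sum_conv_const X Y Z k : (forall w, w \in Z -> conv X Y w = k) ->
  (\sum_(w in Z) conv X Y w = #|Z| * k)%N.
Proof. by move=> h; rewrite -sum_nat_const; apply: eq_bigr. Qed.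

(** For x of nonsquare norm, split the vectors y of square norm according to the
    class of x - y, and sum over x.  Reading each sum from another vertex of
    the triangle 0, x, y gives |sq|^2 = |singular| p + |sq| a + |sq| a: the
    first sum is taken over the singular side, and the second one becomes the
    third one under sigma. *)
Lemma conv_sq_singular_nonsq u w : u \in singular -> w \in nonsq ->
  conv sq sq u = conv sq sq w.
Proof.
move=> uS wN.
have /andP[u0 /eqP qu] : (u != 0) && (q u == 0) by rewrite -mem_singular.
have w0 : w != 0 by move: wN; rewrite inE => /andP[].
have aE x : x \in nonsq -> conv sq sq x = conv sq sq w.
  move: wN; rewrite !mem_nonsq => nw nx.
  apply: conv_nonsingular; try exact: square_stable_nzsquares; try exact: nonsquare_neq0.
  by rewrite (negPf nw) (negPf nx).
have dNS := disjoint_nonsquares_nzsquares F.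
have dS0 : [disjoint nzsquares F & [set 0]].
  by rewrite disjoint_sym disjoint_zero_nzsquares.
have sqN : #|sq| = #|nonsq| by rewrite card_nonsq.
apply: (@conv_sq_arith #|F| (#|F| ^ n)%N #|nzsquares F| #|[set x | q x == 1]|
  #|sq| #|singular| (conv sq singular u) (conv sq nonsq u)).
- exact: card_nzsquares.
- by rewrite card_level_partition card_nonsq.
- exact: card_sq.
- rewrite -norm_fiber_square_eq; congr (_ + _)%N; congr (_ * _)%N; congr (_ ^ _)%N.
  rewrite [RHS](cardsD1 0) inE (quad0 q_nondeg) eqxx addnC; congr (_ + _)%N.
  by apply: eq_card => x; rewrite mem_singular !inE.
- by rewrite [LHS](card_conv_partition sq u) mem_sq qu eqxx addn0.
- by rewrite conv_singular // cards1 muln1.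
- by rewrite convC // conv_singular // 1?card_nonsquares.
- have -> : (#|sq| * #|sq| = \sum_(x in nonsq) #|sq|)%N.
    by rewrite sum_nat_const card_nonsq.
  rewrite (eq_bigr (fun x =>
    conv singular sq x + conv sq nonsq x + conv sq sq x))%N; last first.
    move=> x; rewrite mem_nonsq => nx; rewrite (card_conv_partition sq x) mem_sq.
    by rewrite (negPf nx) andbF addn0 (convC singular).
  rewrite !big_split /= (sum_conv singular nonsq (levelN q_nondeg _)).
  rewrite (sum_conv sq nonsq (levelN q_nondeg _)).
  congr (_ + _ + _)%N.
  + rewrite (sum_conv_const (k := conv sq nonsq u)) // => x xS.
    have /andP[x0 /eqP qx] : (x != 0) && (q x == 0) by rewrite -mem_singular.
    have F_gt0 : (0 < #|F|)%N by rewrite -(card_nzsquares two_neq0).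
    apply/eqP; rewrite -(@eqn_pmul2r (#|F| ^ 2)) ?expn_gt0 ?F_gt0 //; apply/eqP.
    rewrite [conv sq _ _]convC !conv_singular //.
  + rewrite (sum_conv_const (k := conv sq sq w)) // => x xS.
    rewrite -conv_sigma_sq aE //.
    by rewrite (mem_level_similarity x sigma_sim eta_nonsquares).
  + by rewrite (sum_conv_const (k := conv sq sq w)) // card_nonsq.
- by rewrite -card_nonsq; apply/card_gt0P; exists w.
Qed.

Lemma conv_singular_const S T u w : [disjoint S & T] ->
  u \in singular -> w \in singular ->
  conv (level q S) (level q T) u = conv (level q S) (level q T) w.
Proof.
move=> dST; rewrite !mem_singular => /andP[u0 /eqP qu] /andP[w0 /eqP qw].
apply/eqP; rewrite -(@eqn_pmul2r (#|F| ^ 2)); last first.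
  by rewrite -(card_nzsquares two_neq0).
by rewrite !conv_singular.
Qed.

Lemma two_valued_sq : two_valued sq.
Proof.
have dNS : [disjoint nzsquares F & nonsquares F].
  by rewrite disjoint_sym disjoint_nonsquares_nzsquares.
have dS0 : [disjoint nzsquares F & [set 0]].
  by rewrite disjoint_sym disjoint_zero_nzsquares.
have sing0 u w : u != 0 -> q u = 0 -> w != 0 -> w \notin sq ->
    conv sq sq u = conv sq sq w.
  move=> u0 qu w0 nw; have uS : u \in singular by rewrite mem_singular u0 qu /=.
  have [qw|qw] := eqVneq (q w) 0; last first.
    by apply: conv_sq_singular_nonsq; rewrite // mem_nonsq; move: nw; rewrite mem_sq qw.
  have wS : w \in singular by rewrite mem_singular w0 qw /=.
  have := card_conv_partition sq u; rewrite {1}(card_conv_partition sq w) (negPf nw).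
  rewrite mem_sq qu eqxx (conv_singular_const dNS uS wS) (conv_singular_const dS0 uS wS).
  by rewrite !addn0 => /addnI.
move=> u w u0 w0 uw.
have [qu|qu] := eqVneq (q u) 0.
  by apply: sing0 => //; rewrite -uw mem_sq qu eqxx.
have [qw|qw] := eqVneq (q w) 0.
  by apply/esym/sing0 => //; rewrite uw mem_sq qw eqxx.
apply: conv_nonsingular; rewrite ?qu //; try exact: square_stable_nzsquares.
by move: uw; rewrite !mem_sq qu qw.
Qed.

(** The similarity sigma exchanges square and nonsquare norms. *)
Lemma two_valued_nonsq : two_valued nonsq.
Proof.
move=> u w u0 w0 uw; rewrite -!conv_sigma_sq; apply: two_valued_sq.
- by rewrite (similarity_eq0 _ sigma_sim).
- by rewrite (similarity_eq0 _ sigma_sim).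
by rewrite !(mem_level_similarity _ sigma_sim eta_nzsquares).
Qed.

(** Off the singular vectors, sigma moves a vector of nonsquare norm to one of
    square norm and preserves the singular level set. *)
Lemma two_valued_singular : two_valued singular.
Proof.
have d0N := disjoint_zero_nonsquares F; have d0S := disjoint_zero_nzsquares F.
move=> u w u0 w0 uw.
have [uS|uS] := boolP (u \in singular).
  have wS : w \in singular by rewrite -uw.
  have := card_conv_partition singular u; rewrite {1}(card_conv_partition singular w).
  rewrite uS wS (conv_singular_const d0N uS wS) (conv_singular_const d0S uS wS).
  by move=> /addIn /addIn /addIn.
have qu : q u != 0 by move: uS; rewrite mem_singular u0.
have qw : q w != 0 by move: uS; rewrite uw mem_singular w0.
have nonsq_sq x y : q x != 0 -> q y != 0 -> ~~ is_square (q x) -> is_square (q y) ->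
    conv singular singular x = conv singular singular y.
  move=> qx qy nx sy; rewrite -(conv_similarity x sigma_sim eta_zero eta_zero).
  have [_ _ qs] := sigma_sim.
  apply: conv_nonsingular => //; try exact: square_stable0.
    by rewrite qs mulf_neq0 // nonsquare_neq0.
  by rewrite qs is_squareM_nonsquare // nx sy orbT.
have [squ|nu] := boolP (is_square (q u)); have [sqw|nw] := boolP (is_square (q w)).
- by apply: conv_nonsingular; rewrite ?squ ?sqw //; exact: square_stable0.
- by apply/esym/nonsq_sq.
- exact: nonsq_sq.
by apply: conv_nonsingular; rewrite ?(negPf nu) ?(negPf nw) //; exact: square_stable0.
Qed.

End TwoValued.

(** * The standard forms *)

Lemma natr_card (F : finFieldType) : #|F|%:R = 0 :> F.
Proof.
have := expg_cardG (G := [set: F]%G) (in_setT (1 : F)).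
by rewrite FinRing.zmodXgE cardsT.
Qed.

Lemma two_neq0_of_odd_card (F : finFieldType) : odd #|F| -> 2%:R != 0 :> F.
Proof.
move=> oF; apply/eqP=> two0; have := natr_card F.
rewrite -(odd_double_half #|F|) oF natrD -mul2n natrM two0 mul0r addr0.
by move/eqP; rewrite oner_eq0.
Qed.

Section StandardForm.

Variables (F : finFieldType) (m : nat) (eps : sign) (b : F).
Hypothesis two_neq0 : 2%:R != 0 :> F.
Hypothesis b_nonsquare : eps = Minus -> ~~ is_square (- b).
Local Notation V := 'rV[F]_(m.*2).
Local Notation q := (Q eps b : V -> F).
Implicit Types (x y z w : V) (i : 'I_m).

Definition block (i : 'I_m) (y z : F) : F :=
  match eps with
  | Plus => y * z
  | Minus => if i.+1 == m then y ^+ 2 + b * z ^+ 2 else y * z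
  end.

Lemma QE x : q x = \sum_i block i (x 0 (fst_ord i)) (x 0 (snd_ord i)).
Proof. by []. Qed.

Definition block_pol (i : 'I_m) (y z y' z' : F) : F :=
  match eps with
  | Plus => y * z' + z * y'
  | Minus => if i.+1 == m then 2%:R * (y * y' + b * (z * z')) else y * z' + z * y'
  end.

Lemma pol_QE x y : pol q x y = \sum_i block_pol i
  (x 0 (fst_ord i)) (x 0 (snd_ord i)) (y 0 (fst_ord i)) (y 0 (snd_ord i)).
Proof.
rewrite /pol !QE -!sumrB; apply: eq_bigr => i _; rewrite !mxE /block /block_pol.
by case: eps; [ring | case: eqP => _; ring].
Qed.

Lemma row_eq0_blocks x :
  (forall i, x 0 (fst_ord i) = 0 /\ x 0 (snd_ord i) = 0) -> x = 0.
Proof.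
move=> x0; apply/rowP=> j; rewrite mxE.
have jm : (j./2 < m)%N by rewrite ltn_half_double.
have [x1 x2] := x0 (Ordinal jm).
have := odd_double_half j; case: (odd j) => /= ej.
  by rewrite -x2; congr (x 0 _); apply: val_inj; rewrite /= -[LHS]ej add1n.
by rewrite -x1; congr (x 0 _); apply: val_inj; rewrite /= -[LHS]ej add0n.
Qed.

Lemma fst_ord_eq i k : (fst_ord i == fst_ord k) = (i == k).
Proof. by rewrite -!val_eqE /= -!muln2 eqn_mul2r. Qed.

Lemma snd_ord_eq i k : (snd_ord i == snd_ord k) = (i == k).
Proof. by rewrite -!val_eqE /= eqSS -!muln2 eqn_mul2r. Qed.

Lemma fst_snd_ord i k : (fst_ord i == snd_ord k) = false.
Proof. by rewrite -val_eqE /=; apply/eqP => /(congr1 odd); rewrite /= !odd_double. Qed.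

Definition ord_neq := (fst_ord_eq, snd_ord_eq, fst_snd_ord,
  fun i k => etrans (eq_sym (snd_ord k) (fst_ord i)) (fst_snd_ord i k)).

Lemma pol_Q_delta_fst i w :
  pol q (delta_mx 0 (fst_ord i)) w =
  block_pol i 1 0 (w 0 (fst_ord i)) (w 0 (snd_ord i)).
Proof.
rewrite pol_QE (bigD1 i) //= big1 ?addr0 => [|k ki]; rewrite !mxE !ord_neq ?eqxx //=.
rewrite (negPf ki) /block_pol /=; case: eps; first by ring.
by case: ifP => _ /=; ring.
Qed.

Lemma pol_Q_delta_snd i w :
  pol q (delta_mx 0 (snd_ord i)) w =
  block_pol i 0 1 (w 0 (fst_ord i)) (w 0 (snd_ord i)).
Proof.
rewrite pol_QE (bigD1 i) //= big1 ?addr0 => [|k ki]; rewrite !mxE !ord_neq ?eqxx //=.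
rewrite (negPf ki) /block_pol /=; case: eps; first by ring.
by case: ifP => _ /=; ring.
Qed.

Lemma Q_nondeg : nondeg_quadratic q.
Proof.
split.
- move=> a x; rewrite !QE mulr_sumr; apply: eq_bigr => i _; rewrite !mxE /block.
  by case: eps; [ring | case: ifP => _; ring].
- move=> x y z; rewrite !pol_QE -big_split /=; apply: eq_bigr => i _.
  by rewrite !mxE /block_pol; case: eps; [ring | case: ifP => _; ring].
- move=> a x z; rewrite !pol_QE mulr_sumr; apply: eq_bigr => i _.
  by rewrite !mxE /block_pol; case: eps; [ring | case: ifP => _; ring].
move=> w w0; suff /existsP : [exists z : V, pol q z w != 0] by [].
apply: contraNT w0 => /existsPn pol0; apply/eqP/row_eq0_blocks => i.
have := pol0 (delta_mx 0 (fst_ord i)); have := pol0 (delta_mx 0 (snd_ord i)).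
rewrite !negbK pol_Q_delta_fst pol_Q_delta_snd /block_pol.
case: eps b_nonsquare => [_|/(_ erefl)/nonsquare_neq0].
  by rewrite !(mul1r, mul0r, add0r, addr0) => /eqP-> /eqP->.
rewrite oppr_eq0 => b0; case: ifP => _.
  rewrite !(mul1r, mul0r, mulr0, add0r, addr0) !mulf_eq0 (negPf two_neq0) (negPf b0) /=.
  by move=> /eqP-> /eqP->.
by rewrite !(mul1r, mul0r, add0r, addr0) => /eqP-> /eqP->.
Qed.

(** With at least two coordinate pairs the first one is hyperbolic. *)
Lemma Q_singular : (2 <= m)%N -> exists2 x : V, x != 0 & q x = 0.
Proof.
move=> m_ge2; have m_gt0 : (0 < m)%N by apply: leq_trans m_ge2.
pose i := Ordinal m_gt0; exists (delta_mx 0 (fst_ord i)).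
  apply/eqP=> /rowP/(_ (fst_ord i)); rewrite !mxE !eqxx => /eqP.
  by rewrite oner_eq0.
rewrite QE big1 // => k _; rewrite !mxE !ord_neq /= /block.
case: eps => /=; first by rewrite mulr0.
case: ifP => km; last by rewrite mulr0.
have -> : (k == i) = false.
  by apply: contraTF km => /eqP->; rewrite /= neq_ltn m_ge2.
by rewrite !expr0n mulr0 addr0.
Qed.

(** A binary form y^2 + b z^2 with -b a nonsquare represents a nonsquare:
    trivially b itself if b is a nonsquare; otherwise -1 is a nonsquare, so
    somewhere in 0, 1, 2, ..., -1 a square u^2 is followed by a nonsquare. *)
Lemma binary_form_nonsquare : ~~ is_square (- b) ->
  exists s t, ~~ is_square (s ^+ 2 + b * t ^+ 2).
Proof.
move=> nb; have [/is_squareP[c bc]|nsb] := boolP (is_square b); last first.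
  by exists 0, 1; rewrite expr0n expr1n mulr1 add0r.
have c0 : c != 0.
  by apply: contraNneq (nonsquare_neq0 nb) => c0; rewrite bc c0 expr0n oppr0.
have F_gt0 : (0 < #|F|)%N by apply/card_gt0P; exists 0.
have ex : exists k, ~~ is_square (k%:R : F).
  exists #|F|.-1; have := natr_card F; rewrite -{1}(prednK F_gt0) -natr1 => /eqP.
  by rewrite addr_eq0 => /eqP->; move: nb; rewrite bc -mulrN1 is_squareMl.
case: (ex_minnP ex) => -[|k] nsk mink; first by rewrite is_square0 in nsk.
have /is_squareP[u ku] : is_square (k%:R : F).
  by apply: contraT => /mink; rewrite ltnn.
exists u, c^-1; rewrite bc exprVn divff ?expf_neq0 //.
by rewrite -ku natr1.
Qed.

Lemma half_ord_proof (j : 'I_(m.*2)) : (j./2 < m)%N.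
Proof. by rewrite ltn_half_double. Qed.

Definition blockwise (f g : 'I_m -> F -> F -> F) (x : V) : V :=
  \row_j let i := Ordinal (half_ord_proof j) in
         let h := if odd j then g else f in
         h i (x 0 (fst_ord i)) (x 0 (snd_ord i)).

Lemma blockwise_fst f g x i :
  blockwise f g x 0 (fst_ord i) = f i (x 0 (fst_ord i)) (x 0 (snd_ord i)).
Proof.
rewrite mxE /= odd_double; have -> // : Ordinal (half_ord_proof (fst_ord i)) = i.
by apply: val_inj; rewrite /= doubleK.
Qed.

Lemma blockwise_snd f g x i :
  blockwise f g x 0 (snd_ord i) = g i (x 0 (fst_ord i)) (x 0 (snd_ord i)).
Proof.
rewrite mxE /= odd_double; have -> // : Ordinal (half_ord_proof (snd_ord i)) = i.
by apply: val_inj; rewrite /= uphalf_double.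
Qed.

End StandardForm.

(** A multiple of a nondegenerate form is nondegenerate, whence injectivity. *)
Lemma similarity_of_additive (F : finFieldType) n (q : 'rV[F]_n -> F) c s :
  nondeg_quadratic q -> c != 0 -> {morph s : x y / x - y} ->
  (forall x, q (s x) = c * q x) -> similarity q c s.
Proof.
move=> qnd c0 sB qs; split=> // x y exy.
have s0 : s 0 = 0 by rewrite -[0 in LHS](subrr 0) sB subrr.
have sN z : s (- z) = - s z by rewrite -sub0r sB s0 sub0r.
have sD u z : s (u + z) = s u + s z by rewrite -[z in LHS]opprK sB sN opprK.
apply/eqP; rewrite -subr_eq0; apply: contraT => /(pol_nondeg qnd)[z].
have : c * pol q z (x - y) = 0.
  have -> : c * pol q z (x - y) = pol q (s z) (s (x - y)).
    by rewrite /pol -sD !qs; ring.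
  by rewrite sB exy subrr -(scale0r 0) polZr // mul0r.
by move/eqP; rewrite mulf_eq0 (negPf c0) /= => ->.
Qed.

(** On a hyperbolic pair, (y, z) |-> (eta y, z) multiplies y z by eta; on the
    anisotropic pair, y^2 + b z^2 is the norm form of the quadratic extension
    by sqrt(-b), and multiplication by an element s + t sqrt(-b) multiplies
    it by the norm of that element. *)
Lemma nonsquare_similarity (F : finFieldType) m eps (b : F) :
  2%:R != 0 :> F -> (eps = Minus -> ~~ is_square (- b)) ->
  exists (eta : F) sigma,
    ~~ is_square eta /\ similarity (@Q F m eps b) eta sigma.
Proof.
move=> two_neq0 nb.
have [eta [s [t [neta etast]]]] : exists eta s t : F,
    ~~ is_square eta /\ (eps = Minus -> eta = s ^+ 2 + b * t ^+ 2).
  case: eps nb => [_|/(_ erefl)/binary_form_nonsquare[s [t st]]].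
    by have [a na] := nonsquare_exists two_neq0; exists a, 0, 0.
  by exists (s ^+ 2 + b * t ^+ 2), s, t.
pose aniso (i : 'I_m) := (if eps is Minus then i.+1 == m else false).
pose f i y z : F := if aniso i then s * y - b * t * z else eta * y.
pose g i y z : F := if aniso i then t * y + s * z else z.
exists eta, (blockwise f g); split=> //.
apply: similarity_of_additive (nonsquare_neq0 neta) _ _; first exact: Q_nondeg.
  move=> x y; apply/rowP=> j; rewrite !mxE /f /g.
  by case: odd => /=; rewrite !mxE; case: (aniso _); ring.
move=> x; rewrite !QE mulr_sumr; apply: eq_bigr => i _.
rewrite blockwise_fst blockwise_snd /block /f /g /aniso.
clear f g aniso nb; case: eps etast => [_|/(_ erefl)->]; first by ring.
by case: (i.+1 == m); ring.
Qed.

(** * Regular groups of affine isometries *)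

Lemma graph_iso_sym (T1 T2 : finType) (e1 : rel T1) (e2 : rel T2) :
  graph_iso e1 e2 -> graph_iso e2 e1.
Proof.
move=> [f [g fK gK] ef]; exists g; first by exists f.
by move=> x y; rewrite -ef !gK.
Qed.

Lemma graph_iso_trans (T1 T2 T3 : finType) (e1 : rel T1) (e2 : rel T2) (e3 : rel T3) :
  graph_iso e1 e2 -> graph_iso e2 e3 -> graph_iso e1 e3.
Proof.
move=> [f f_bij ef] [g g_bij eg]; exists (g \o f); first exact: bij_comp.
by move=> x y; rewrite /= eg ef.
Qed.

Section RegularGroup.

Variables (F : finFieldType) (n : nat) (q : 'rV[F]_n -> F).
Local Notation V := 'rV[F]_n.
Hypothesis q_nondeg : nondeg_quadratic q.
Variables (v : V) (A : F -> gl F n).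
Hypothesis v_norm : pol q v v != 0.
Hypothesis AD : forall a c, A (a + c) = (A a * A c)%g.
Hypothesis A_isometry : forall a x, q (x *m A a) = q x.
Hypothesis A_fix : forall a, v *m A a = v.
Implicit Types (x y w : V) (X : {set V}) (a c : F).

(** The coefficient of v in the decomposition of x along v and v^perp. *)
Definition vcoord x : F := pol q x v / pol q v v.

(** The element of the regular group that moves 0 to x. *)
Definition lift_vec x : agl F n := Agl (A (vcoord x)) x.

Lemma vcoordD x y : vcoord (x + y) = vcoord x + vcoord y.
Proof. by rewrite /vcoord (polDl q_nondeg) mulrDl. Qed.

Lemma vcoordN x : vcoord (- x) = - vcoord x.
Proof. by rewrite /vcoord (polNl q_nondeg) mulNr. Qed.

Lemma vcoord_v a : vcoord (a *: v) = a.
Proof. by rewrite /vcoord (polZl q_nondeg) mulfK. Qed.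

Lemma vcoord_perp x : (vcoord x == 0) = (pol q x v == 0).
Proof. by rewrite mulf_eq0 invr_eq0 (negPf v_norm) orbF. Qed.

(** beta (x A) v = beta (x A) (v A) = beta x v. *)
Lemma vcoordA a x : vcoord (x *m A a) = vcoord x.
Proof.
congr (_ / _); rewrite -{1}(A_fix a) /pol.
by rewrite -mulmxDl !A_isometry.
Qed.

Lemma A0 : A 0 = 1%g.
Proof. by apply: (mulgI (A 0)); rewrite -AD addr0 mulg1. Qed.

Lemma AN a : A (- a) = (A a)^-1%g.
Proof. by apply: (mulgI (A a)); rewrite -AD subrr A0 mulgV. Qed.

Lemma aglM (M N : gl F n) x y : (Agl M x * Agl N y)%g = Agl (M * N)%g (x *m N + y).
Proof. by []. Qed.

Lemma lift_vec_inj : injective lift_vec.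
Proof. by move=> x y []. Qed.

(** The A-parts multiply correctly because vcoord is additive and A-invariant. *)
Lemma lift_vecM x y : (lift_vec x * lift_vec y)%g = lift_vec (x *m A (vcoord y) + y).
Proof. by rewrite aglM -AD /lift_vec vcoordD vcoordA. Qed.

Lemma lift_vec0 : lift_vec 0 = 1%g.
Proof. by rewrite /lift_vec /vcoord -(scale0r 0) (polZl q_nondeg) !mul0r A0 scale0r. Qed.

Lemma lift_vecV x : (lift_vec x)^-1%g = lift_vec (- (x *m A (- vcoord x))).
Proof.
apply: (mulIg (lift_vec x)); rewrite mulVg lift_vecM mulNmx -mulmxA.
have -> : A (- vcoord x) *m A (vcoord x) = (A (- vcoord x) * A (vcoord x))%g by [].
by rewrite AN mulVg mulmx1 addNr lift_vec0.
Qed.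

Lemma lift_vec_div x y :
  (lift_vec x * (lift_vec y)^-1)%g = lift_vec ((x - y) *m A (- vcoord y)).
Proof. by rewrite lift_vecV lift_vecM vcoordN vcoordA mulmxBl. Qed.

Variable G : {group agl F n}.
Hypothesis G_lift : G = lift_vec @: setT :> {set agl F n}.

Lemma mem_lift_vec x : lift_vec x \in G.
Proof. by rewrite G_lift imset_f. Qed.

Lemma lift_vec_trans g : g \in G -> lift_vec (agl_trans g) = g.
Proof. by rewrite G_lift => /imsetP[x _ ->]. Qed.

Lemma mem_lift_imset X x : (lift_vec x \in lift_vec @: X) = (x \in X).
Proof. exact: (mem_imset _ _ lift_vec_inj). Qed.

Section CayleySet.

Variable X : {set V}.
Hypothesis X_sym : forall x, (- x \in X) = (x \in X).
Hypothesis XA : forall a x, (x *m A a \in X) = (x \in X).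
Local Notation D := (lift_vec @: X).

(** The map g |-> 0^g; since X is A-invariant, lift_vec_div makes adjacency
    depend only on the difference of the two vectors. *)
Lemma graph_iso_Cay (e : rel V) : (forall u w, e u w = (u - w \in X)) ->
  graph_iso (Cay G D) e.
Proof.
move=> eE; exists (fun g => agl_trans (sgval g)).
  exists (fun x => subg G (lift_vec x)) => [g|x].
    by rewrite lift_vec_trans ?subgP // sgvalK.
  by rewrite subgK // mem_lift_vec.
move=> g h; rewrite eE /Cay -{2}(lift_vec_trans (subgP g)) -{2}(lift_vec_trans (subgP h)).
by rewrite lift_vec_div mem_lift_imset XA.
Qed.

Lemma lift_imsetV : D^-1%g = D.
Proof.
apply/setP=> g; rewrite inE; have half h : h \in D -> h^-1%g \in D.
  by case/imsetP=> x xX ->; rewrite lift_vecV mem_lift_imset X_sym XA.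
by apply/idP/idP => [/half|/half //]; rewrite invgK.
Qed.

(** In d1 d2^-1 = lift_vec w, put d2^-1 = lift_vec x; then d1 is the quotient
    of lift_vec w by lift_vec x, which lies over an isometric image of w - x. *)
Lemma quotient_reps_conv w : quotient_reps D (lift_vec w) = conv X X w.
Proof.
rewrite /conv; pose h x := ((lift_vec w * (lift_vec x)^-1)%g, (lift_vec x)^-1%g).
rewrite -(card_imset _ (f := h)); last by move=> x y /(congr1 snd)/invg_inj/lift_vec_inj.
apply: eq_card => -[d1 d2]; rewrite inE /=; apply/and3P/imsetP.
  move=> [d1D d2D /eqP e].
  have : d2^-1%g \in D by rewrite -[D]lift_imsetV inE invgK.
  case/imsetP=> x xX d2x; have e1 : d1 = (lift_vec w * (lift_vec x)^-1)%g.
    by rewrite -e -d2x invgK mulgKV.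
  exists x; last by rewrite /h -e1 -d2x invgK.
  by rewrite inE xX; move: d1D; rewrite e1 lift_vec_div mem_lift_imset XA.
case=> x; rewrite inE => /andP[xX wxX] [-> ->]; split.
- by rewrite lift_vec_div mem_lift_imset XA.
- by rewrite -[D]lift_imsetV inE invgK mem_lift_imset.
by rewrite invgK mulgKV.
Qed.

(** By quotient_reps_conv it only remains to pick the two values, arbitrarily
    when the class on which they are taken is empty. *)
Lemma two_valued_is_pds : 0 \notin X -> two_valued X -> is_pds G D.
Proof.
move=> X0 tvX.
have const (P : pred V) : (forall w, P w -> w != 0) ->
    (forall u w, P u -> P w -> (u \in X) = (w \in X)) ->
    exists k, forall w, P w -> quotient_reps D (lift_vec w) = k.
  move=> P0 PX; have [w0 Pw0|noP] := pickP P; last first.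
    by exists 0%N => w; rewrite noP.
  by exists (conv X X w0) => w Pw; rewrite quotient_reps_conv; apply: tvX; auto.
have [lam lamE] : exists k, forall w, w \in X -> quotient_reps D (lift_vec w) = k.
  apply: (const (fun w => w \in X)) => [w|u w -> ->] //.
  by apply: contraTneq => ->.
have [mu muE] : exists k, forall w,
    (w \notin X) && (w != 0) -> quotient_reps D (lift_vec w) = k.
  apply: (const (fun w => (w \notin X) && (w != 0))) => [w|u w] /andP[] //.
  by move=> /negPf-> _ /andP[/negPf-> _].
exists #|G|, #|D|, lam, mu; split; last exact: lift_imsetV.
  split=> // [|g|g].
  - by rewrite G_lift imsetS // subsetT.
  - by case/imsetP=> x xX -> _; exact: lamE.
  - case/setDP => gG; rewrite -(lift_vec_trans gG) mem_lift_imset => gX g1.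
    by apply: muE; rewrite gX; apply: contraNneq g1 => ->; rewrite lift_vec0.
by rewrite -lift_vec0 mem_lift_imset.
Qed.

End CayleySet.

End RegularGroup.

(** * The group G_1 *)

Lemma mulmx_expg (F : finFieldType) n (M : gl F n) (v : 'rV[F]_n) c k :
  v *m M = c *: v -> v *m (M ^+ k)%g = c ^+ k *: v.
Proof.
move=> vM; elim: k => [|k IH]; first by rewrite mulmx1 scale1r.
rewrite expgS exprS -scalerA.
have -> : glmx (M * M ^+ k)%g = M *m (M ^+ k)%g by [].
by rewrite mulmxA vM -scalemxAl IH.
Qed.

(** v M = c v with c^2 = 1 because Q v is nonzero, and c^p = 1 with p odd. *)
Lemma line_stab_fix (F : finFieldType) m eps (b : F) (v : 'rV[F]_(m.*2)) p
    (M : gl F m.*2) :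
  2%:R != 0 :> F -> (eps = Minus -> ~~ is_square (- b)) -> Q eps b v != 0 -> odd p ->
  M \in SO_line_stab eps b v -> (M ^+ p = 1)%g -> v *m M = v.
Proof.
move=> two_neq0 nb Qv p_odd; rewrite !inE => /andP[/andP[_ /forallP MQ] /andP[vMv _]] Mp.
have [c vM] := sub_rVP vMv.
have c2 : c ^+ 2 = 1.
  have /eqP := MQ v; rewrite vM (quadZ (Q_nondeg m two_neq0 nb)) -[RHS]mul1r.
  by move/(mulIf Qv).
have v0 : v != 0.
  by apply: contraNneq Qv => ->; rewrite (quad0 (Q_nondeg m two_neq0 nb)).
have cp : c ^+ p = 1.
  have := mulmx_expg p vM; rewrite Mp mulmx1 => /esym/eqP.
  rewrite -subr_eq0 -[X in _ - X]scale1r -scalerBl scaler_eq0 (negPf v0) orbF subr_eq0.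
  by move/eqP.
move: cp; rewrite -(odd_double_half p) p_odd exprS -mul2n exprM c2 expr1n mulr1.
by rewrite vM => ->; rewrite scale1r.
Qed.

Section GroupG1.

Variables (F : finFieldType) (m : nat) (eps : sign) (b : F).
Local Notation V := 'rV[F]_(m.*2).
Local Notation q := (@Q F m eps b).
Hypothesis q_nondeg : nondeg_quadratic q.
Variables (v : V) (A : F -> gl F m.*2).
Hypothesis v_norm : pol q v v != 0.
Hypothesis AD : forall a c, A (a + c) = (A a * A c)%g.
Hypothesis A_isometry : forall a x, q (x *m A a) = q x.
Hypothesis A_fix : forall a, v *m A a = v.

Local Notation lift := (lift_vec q v A).

(** The generators are lifts; conversely lift_vec x is a translation by a vector
    of v^perp times the generator [A_a, a v] with a = vcoord x. *)
Lemma G1_lift : G1 eps b v A = lift @: setT :> {set agl F m.*2}.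
Proof.
have gs : group_set (lift @: setT).
  apply/group_setP; split; first by apply/imsetP; exists 0; rewrite ?inE // lift_vec0.
  by move=> _ _ /imsetP[x _ ->] /imsetP[y _ ->]; rewrite lift_vecM // imset_f.
have trans_lift u : u \in perp eps b v -> Agl 1%g u = lift u.
  rewrite inE => uv; have /eqP cu : vcoord q v u == 0 by rewrite vcoord_perp.
  by rewrite /lift_vec cu A0.
apply/eqP; rewrite eqEsubset; apply/andP; split.
  rewrite -[lift @: setT]/(gval (Group gs)) gen_subG subUset; apply/andP; split.
    by apply/subsetP=> _ /imsetP[u uv ->]; rewrite trans_lift // imset_f.
  apply/subsetP=> _ /imsetP[a _ ->]; apply/imsetP; exists (a *: v) => //.
  by rewrite /lift_vec vcoord_v.
apply/subsetP=> _ /imsetP[x _ ->].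
pose a := vcoord q v x; pose u := (x - a *: v) *m A (- a).
have uv : u \in perp eps b v.
  by rewrite inE -(vcoord_perp v_norm) vcoordA // vcoordD // vcoordN // vcoord_v // subrr.
have -> : lift x = (Agl 1%g u * Agl (A a) (a *: v))%g.
  rewrite aglM mul1g /u -mulmxA.
  have -> : A (- a) *m A a = (A (- a) * A a)%g by [].
  by rewrite -AD addNr A0 // mulmx1 subrK.
by apply: groupM; apply: mem_gen; rewrite inE; apply/orP; [left|right]; apply: imset_f.
Qed.

Lemma card_G1 : #|G1 eps b v A| = (#|F| ^ m.*2)%N.
Proof. by rewrite G1_lift card_imset ?card_V //; exact: lift_vec_inj. Qed.

(** If the translations by v^perp commuted with [A_a, a v], then A_a would fix
    v^perp pointwise; fixing v as well, it would be the identity. *)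
Lemma G1_nonabelian : injective A -> ~~ abelian (G1 eps b v A).
Proof.
move=> A_inj; apply/negP=> /centsP ab.
suff : A 1 = A 0 by move/A_inj/eqP; rewrite oner_eq0.
rewrite A0 //; apply: val_inj => /=; apply/row_matrixP=> i.
rewrite rowE [RHS]rowE mulmx1; set x := delta_mx 0 i.
pose a := vcoord q v x; pose u := x - a *: v.
have uv : u \in perp eps b v.
  by rewrite inE -(vcoord_perp v_norm) vcoordD // vcoordN // vcoord_v // subrr.
have uG : Agl 1%g u \in G1 eps b v A.
  by apply: mem_gen; rewrite inE imset_f.
have vG : Agl (A 1) (1 *: v) \in G1 eps b v A.
  by apply: mem_gen; rewrite inE; apply/orP; right; apply: imset_f.
have := congr1 (@agl_trans _ _) (ab _ uG _ vG).
rewrite !aglM /= mulmx1 [RHS]addrC => /addIr uA.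
by rewrite -(subrK (a *: v) x) -/u mulmxDl uA -scalemxAl A_fix.
Qed.

End GroupG1.

(** * The partition into three partial difference sets *)

Lemma partition3 (T : finType) (X0 X1 X2 Y : {set T}) :
  X0 != set0 -> X1 != set0 -> X2 != set0 ->
  [disjoint X0 & X1] -> [disjoint X0 & X2] -> [disjoint X1 & X2] ->
  Y = X0 :|: X1 :|: X2 ->
  uniq [:: X0; X1; X2] /\ partition [set X0; X1; X2] Y.
Proof.
move=> n0 n1 n2 d01 d02 d12 ->.
have neq (X Z : {set T}) : X != set0 -> [disjoint X & Z] -> X != Z.
  by move=> X0n; apply: contraTneq => <-; rewrite -setI_eq0 setIid.
split.
  by rewrite /= !inE negb_or (neq _ _ n0 d01) (neq _ _ n0 d02) (neq _ _ n1 d12).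
apply/and3P; split.
- apply/eqP/setP=> x; apply/bigcupP/idP => [[X]|].
    by rewrite !inE -orbA => /or3P[]/eqP-> ->; rewrite ?orbT.
  rewrite !inE -orbA => /or3P[] xX; [exists X0|exists X1|exists X2] => //.
  - by rewrite !inE eqxx.
  - by rewrite !inE eqxx orbT.
  - by rewrite !inE eqxx orbT.
- apply/trivIsetP=> X Z; rewrite !inE -!orbA.
  by case/or3P=> /eqP-> /or3P[] /eqP->; rewrite ?eqxx // disjoint_sym.
by rewrite !inE !negb_or ![set0 == _]eq_sym n0 n1 n2.
Qed.

Lemma levelU_nonzero (F : finFieldType) n (q : 'rV[F]_n -> F) :
  [set x | x != 0] =
  level q [set 0] :|: level q (nonsquares F) :|: level q (nzsquares F).
Proof.
apply/setP=> x; rewrite !inE; case: (x != 0) => //=.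
by case: (q x == 0); case: is_square.
Qed.

Lemma disjoint_level (F : finFieldType) n (q : 'rV[F]_n -> F) (S T : {set F}) :
  [disjoint S & T] -> [disjoint level q S & level q T].
Proof.
move=> dST; apply/pred0P=> x /=; rewrite !inE.
by apply/negP=> /andP[/andP[_ xS] /andP[_]]; rewrite (disjointFr dST).
Qed.

Lemma disjoint_imset (T R : finType) (f : T -> R) (X Y : {set T}) :
  injective f -> [disjoint X & Y] -> [disjoint f @: X & f @: Y].
Proof.
move=> f_inj dXY; apply/pred0P=> y /=; apply/negP=> /andP[/imsetP[x xX ->]].
by rewrite mem_imset // (disjointFr dXY).
Qed.

Lemma graph_iso_similarity (F : finFieldType) n (q : 'rV[F]_n -> F) c s
    (S S' : {set F}) :
  similarity q c s -> (forall a, (c * a \in S') = (a \in S)) ->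
  graph_iso (fun u w : 'rV[F]_n => u - w \in level q S)
            (fun u w : 'rV[F]_n => u - w \in level q S').
Proof.
move=> ss SS; have [sB s_inj _] := ss; exists s; first exact: injF_bij.
by move=> x y /=; rewrite -sB (mem_level_similarity _ ss SS).
Qed.

Theorem theorem3p3
  (p e : nat) (p_prime : prime p) (p_odd : odd p)
  (F : finFieldType) (card_F : #|F| = (p ^ e)%N)
  (m : nat) (m_ge2 : (2 <= m)%N)
  (eps : sign) (b : F) (b_nonsquare : eps = Minus -> ~~ is_square (- b))
  (v : 'rV[F]_(m.*2)) (Qv_neq0 : Q eps b v != 0)
  (H : {group gl F m.*2})
  (H_stab : H \subset SO_line_stab eps b v)
  (H_abelem : (p.-abelem H)%g) (card_H : #|H| = #|F|)
  (A : {morphism [set: F] >-> gl F m.*2}) (A_isom : isom [set: F] H A) :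
  let G := G1 eps b v A in
  [/\ ~~ abelian G,
      #|G| = (#|F| ^ m.*2)%N
    & exists D0 D1 D2 : {set agl F m.*2},
        [/\ uniq [:: D0; D1; D2] /\ partition [set D0; D1; D2] (G^#)%g,
            [/\ is_pds G D0, is_pds G D1 & is_pds G D2],
            graph_iso (Cay G D0) (VO m eps b)
          & graph_iso (Cay G D1) (Cay G D2) /\
            graph_iso (Cay G D2) (VNO m eps b)]].
Proof.
set q := (@Q F m eps b).
have two_neq0 : 2%:R != 0 :> F.
  by apply: two_neq0_of_odd_card; rewrite card_F oddX p_odd orbT.
have q_nondeg : nondeg_quadratic q := Q_nondeg m two_neq0 b_nonsquare.
have [eta [sigma [eta_ns sigma_sim]]] := nonsquare_similarity m two_neq0 b_nonsquare.
have v_norm : pol q v v != 0 by rewrite polxx // mulf_neq0.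
have AD a c : A (a + c) = (A a * A c)%g by rewrite -morphM ?inE.
have [A_injm A_im] := isomP A_isom.
have A_inj : injective A by move=> a c /(injmP A_injm) ->; rewrite ?inE.
have AH a : A a \in H by rewrite -A_im mem_morphim ?inE.
have A_isometry a x : q (x *m A a) = q x.
  by have := subsetP H_stab _ (AH a); rewrite !inE => /andP[/andP[_ /forallP/(_ x)/eqP]].
have A_fix a : v *m A a = v.
  apply: (line_stab_fix two_neq0 b_nonsquare Qv_neq0 p_odd).
    exact: (subsetP H_stab).
  by have [_ ->] := abelemP p_prime H_abelem.
have G_lift := G1_lift q_nondeg v_norm AD A_isometry A_fix.
move=> G; split.
- exact: G1_nonabelian.
- exact: card_G1.
pose lift := lift_vec q v A.
have lift_inj : injective lift by exact: lift_vec_inj.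
pose X0 := level q [set 0]; pose X1 := level q (nonsquares F).
pose X2 := level q (nzsquares F).
have eta_sq := eta_nzsquares two_neq0 eta_ns.
have eta_nsq := eta_nonsquares two_neq0 eta_ns.
have XA S a x : (x *m A a \in level q S) = (x \in level q S).
  have ss : similarity q 1 (fun x => x *m A a).
    apply: (similarity_of_additive q_nondeg) => [|y z|y]; first exact: oner_neq0.
      exact: mulmxBl.
    by rewrite A_isometry mul1r.
  by apply: (mem_level_similarity _ ss) => c; rewrite mul1r.
have XN S x : (- x \in level q S) = (x \in level q S) := levelN q_nondeg S x.
have pds S : two_valued (level q S) -> is_pds G (lift @: level q S).
  by apply: two_valued_is_pds => //; rewrite ?inE ?eqxx.
have X0_neq0 : X0 != set0.
  have [x x0 qx] := Q_singular eps b m_ge2.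
  by apply/set0Pn; exists x; rewrite mem_singular x0; apply/eqP.
have [X1_neq0 X2_neq0] : X1 != set0 /\ X2 != set0.
  have [sv|nv] := boolP (is_square (q v)).
    split; apply/set0Pn; last by exists v; rewrite mem_sq // Qv_neq0.
    exists (sigma v); rewrite (mem_level_similarity _ sigma_sim eta_nsq).
    by rewrite mem_sq // Qv_neq0.
  split; apply/set0Pn; first by exists v; rewrite mem_nonsq.
  exists (sigma v); rewrite (mem_level_similarity _ sigma_sim eta_sq).
  by rewrite mem_nonsq.
exists (lift @: X0), (lift @: X1), (lift @: X2); split.
- apply: partition3; rewrite ?imset_eq0 //.
  + exact/disjoint_imset/disjoint_level/disjoint_zero_nonsquares.
  + exact/disjoint_imset/disjoint_level/disjoint_zero_nzsquares.
  + exact/disjoint_imset/disjoint_level/disjoint_nonsquares_nzsquares.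
  rewrite -!imsetU -levelU_nonzero; apply/setP=> g; rewrite G_lift in_setD1.
  apply/andP/imsetP => [[g1 /imsetP[x _ gx]]|[x + ->]].
    by exists x; rewrite // inE; apply: contraNneq g1 => x0; rewrite gx x0 lift_vec0.
  rewrite inE => x0; split; last by rewrite imset_f.
  by rewrite -(lift_vec0 q_nondeg v AD) (inj_eq lift_inj).
- split; apply: pds.
  + exact: two_valued_singular sigma_sim.
  + exact: two_valued_nonsq sigma_sim.
  + exact: two_valued_sq sigma_sim.
- apply: graph_iso_Cay => //; first exact: XA.
  move=> u w.
  by rewrite mem_singular /VO subr_eq0.
have iso2 : graph_iso (Cay G (lift @: X2)) (fun u w : 'rV[F]_(m.*2) => u - w \in X2).
  by apply: graph_iso_Cay => //; exact: XA.
split.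
  apply: graph_iso_trans (graph_iso_sym iso2).
  apply: graph_iso_trans (graph_iso_similarity sigma_sim eta_sq).
  by apply: graph_iso_Cay => //; exact: XA.
apply: graph_iso_Cay => //; first exact: XA.
by move=> u w; rewrite /X2 /level !inE /VNO subr_eq0.
Qed.
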